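(* Consider a non-degenerate model with small steps, zero drift and $\pi/\theta=2$. Its group is finite, of order $4$, if the model has a North–South symmetry ($p_{i,1}=p_{i,-1}$ for all $i$) or an East–West symmetry ($p_{1,j}=p_{-1,j}$ for all $j$); otherwise the group is infinite.
   Context: Let $p_{i,j}\ge0$, $(i,j)\in\{-1,0,1\}^2$, sum to $1$. - Non-degenerate: the list $p_{1,1},p_{1,0},p_{1,-1},p_{0,-1},p_{-1,-1},p_{-1,0},p_{-1,1},p_{0,1}$ has no three consecutive zeros. - Zero drift: $\sum ip=\sum jp=0$. - $\theta=\arccos(-\sum ijp/\sqrt{\sum i^2p\sum j^2p})$, so $\pi/\theta=2$ iff $p_{1,1}+p_{-1,-1}=p_{1,-1}+p_{-1,1}$. Kernel: $K=xy(\sum p_{i,j}x^{-i}y^{-j}-1)=a(x)y^2+b(x)y+c(x)=\tilde a(y)x^2+\tilde b(y)x+\tilde c(y)$. Group: the group of birational transformations of $\overline{\mathbb C}^2$ (not merely their restriction to the curve $K=0$) generated by the involutions $\Phi(x,y)=(x^{-1}\tilde c(y)/\tilde a(y),y)$ and $\Psi(x,y)=(x,y^{-1}c(x)/a(x))$. *)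

(* Defs.v *)
From HB Require Import structures.
From mathcomp Require Import all_boot all_order all_algebra.
From mathcomp Require Import generic_quotient polyXY fraction.
From mathcomp Require Import complex.
From mathcomp Require Import boolp classical_sets functions cardinality.
From mathcomp Require Import reals trigo.

Set Implicit Arguments.
Unset Strict Implicit.
Unset Printing Implicit Defensive.

Import Order.TTheory GRing.Theory Num.Theory.
Local Open Scope classical_set_scope.
Local Open Scope ring_scope.
Local Open Scope complex_scope.

Definition steps : seq int := [:: -1; 0; 1].

(** A model is a weight function [p], of which only the values at
    [steps] x [steps] matter. *)
Section Model.
Variables (R : realType) (p : int -> int -> R).

Definition moment (k l : nat) : R :=
  \sum_(i <- steps) \sum_(j <- steps) i%:~R ^+ k * j%:~R ^+ l * p i j.

Definition is_distribution : Prop :=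
  (forall i j, i \in steps -> j \in steps -> 0 <= p i j) /\
  \sum_(i <- steps) \sum_(j <- steps) p i j = 1.

(** The list is not closed up cyclically. For zero drift this is immaterial:
    if p(0,1) = p(1,1) = p(1,0) = 0, or p(-1,1) = p(0,1) = p(1,1) = 0, then
    zero drift makes three consecutive entries of the list vanish as well. *)
Definition contour : seq R :=
  [:: p 1 1; p 1 0; p 1 (-1); p 0 (-1);
      p (-1) (-1); p (-1) 0; p (-1) 1; p 0 1].

Definition nondegenerate_model : Prop := ~~ infix [:: 0; 0; 0] contour.

Definition zero_drift : Prop := moment 1 0 = 0 /\ moment 0 1 = 0.

Definition angle : R :=
  acos (- (moment 1 1 / Num.sqrt (moment 2 0 * moment 0 2))).

Definition north_south : Prop := forall i, i \in steps -> p i 1 = p i (-1).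

Definition east_west : Prop := forall j, j \in steps -> p 1 j = p (-1) j.

End Model.

(** Bivariate polynomials over the complex numbers are of type
    [{poly {poly R[i]}}], with x = 'X (outer) and y = 'Y (inner). *)
Definition ratfun (R : realType) := {fraction {poly {poly R[i]}}}.

Section RationalMaps.
Variable R : realType.
Local Notation C := R[i].
Local Notation F := (ratfun R).
Implicit Types (f g : F * F) (q : {poly {poly C}}) (r : F).

Definition frac_of q : F := tofrac q.
Definition const_rat (c : C) : F := frac_of c%:P%:P.
Definition xvar : F := frac_of 'X.
Definition yvar : F := frac_of 'Y.

Definition poly_subst q f : F :=
  (map_poly (map_poly const_rat) q).[f.1, f.2].

(** Substitution in a rational function, computed on a chosen fraction. When
    the components of [f] are algebraically independent (in particular when
    [f] is birational) no denominator vanishes and the choice is irrelevant,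
    see [rat_substE]; [rmap_comp f g = rmap_id] with the
    convention z / 0 = 0 still forces the components of [g] to be independent. *)
Definition rat_subst r f : F :=
  poly_subst \n_(repr r) f / poly_subst \d_(repr r) f.

(** A pair [f] of rational functions is the rational self-map
    (x, y) |-> (f.1(x, y), f.2(x, y)) of the product of two projective lines;
    a component identically infinite cannot occur for a birational map. *)
Definition rmap_id : F * F := (xvar, yvar).

(** First [g], then [f]. *)
Definition rmap_comp f g : F * F := (rat_subst f.1 g, rat_subst f.2 g).

Definition rmap_inverse f g : Prop :=
  rmap_comp f g = rmap_id /\ rmap_comp g f = rmap_id.

Definition birational f : Prop := exists g, rmap_inverse f g.

Definition birational_subgroup (G : set (F * F)) : Prop :=
  [/\ G `<=` birational,
      G rmap_id,
      forall f g, G f -> G g -> G (rmap_comp f g)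
    & forall f g, G f -> rmap_inverse f g -> G g].

Lemma rat_substE f (n d : {poly {poly C}}) :
    (forall q, q != 0 -> poly_subst q f != 0) -> d != 0 ->
  rat_subst (frac_of n / frac_of d) f = poly_subst n f / poly_subst d f.
Proof.
move=> f_indep d_neq0.
have fracE : frac_of n / frac_of d = (\pi_F (Ratio n d))%qT.
  rewrite /frac_of; unlock FracField.tofrac.
  rewrite -[X in _ * X]FracField.pi_inv -[LHS]FracField.pi_mul.
  by rewrite /FracField.mulf /FracField.invf /= !numden_Ratio ?(oner_neq0, mul1r, mulr1).
have := FracField.equivf_r (Ratio n d).
rewrite !numden_Ratio // -fracE => eq_nd.
have substM q1 q2 : poly_subst (q1 * q2) f = poly_subst q1 f * poly_subst q2 f.
  pose phi : {rmorphism C -> F} := (@FracField.tofrac {poly {poly C}}) \o (polyC \o polyC).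
  by rewrite /poly_subst -[@const_rat]/(phi : C -> F) rmorphM !hornerM.
apply/eqP; rewrite /rat_subst eqr_div ?f_indep ?denom_ratioP //.
by rewrite -!substM eq_nd mulrC.
Qed.

End RationalMaps.

Section Group.
Variables (R : realType) (p : int -> int -> R).
Local Notation C := R[i].
Local Notation F := (ratfun R).

(** xy (sum p(i,j) x^(-i) y^(-j) - 1), with the product distributed; see
    [kernelE]. *)
Definition kernel : {poly {poly C}} :=
  \sum_(i <- steps) \sum_(j <- steps)
    (p i j)%:C%:P%:P * 'X ^+ `|1 - i|%N * 'Y ^+ `|1 - j|%N - 'X * 'Y.

Lemma kernelE : frac_of kernel =
  xvar R * yvar R *
  (\sum_(i <- steps) \sum_(j <- steps)
      const_rat (p i j)%:C * xvar R ^ (- i) * yvar R ^ (- j) - 1).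
Proof.
have x_neq0 : xvar R != 0 by rewrite tofrac_eq0 polyX_eq0.
have y_neq0 : yvar R != 0 by rewrite tofrac_eq0 polyC_eq0 polyX_eq0.
have expE (z : F) i : z != 0 -> i \in steps -> z * z ^ (- i) = z ^+ `|1 - i|%N.
  move=> z_neq0; rewrite !inE => /or3P[] /eqP->.
  - by rewrite opprK expr1z expr2.
  - by rewrite oppr0 expr0z mulr1 expr1.
  - by rewrite exprN1 mulfV // subrr.
rewrite /frac_of /kernel rmorphB rmorphM mulrBr mulr1; congr (_ - _).
rewrite rmorph_sum mulr_sumr; apply: eq_big_seq => i i_step.
rewrite rmorph_sum mulr_sumr; apply: eq_big_seq => j j_step.
rewrite [LHS]rmorphM [X in X * _]rmorphM [X in _ * X]rmorphXn.
rewrite [X in _ * X * _]rmorphXn.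
transitivity (const_rat (p i j)%:C * xvar R ^+ `|1 - i|%N * yvar R ^+ `|1 - j|%N).
  by [].
rewrite -(expE _ _ x_neq0 i_step) -(expE _ _ y_neq0 j_step).
move: (const_rat _) (xvar R) (yvar R) (xvar R ^ _) (yvar R ^ _) => c x y x' y'.
by rewrite -mulrA (mulrACA x) mulrCA (mulrA c) mulrCA.
Qed.

(** Coefficients of y^2 and y^0 in K, then of x^2 and x^0, all as elements of
    the function field. *)
Definition ker_a : F := frac_of ((swapXY kernel)`_2)^:P.
Definition ker_c : F := frac_of ((swapXY kernel)`_0)^:P.
Definition ker_a' : F := frac_of (kernel`_2)%:P.
Definition ker_c' : F := frac_of (kernel`_0)%:P.

Definition Phi : F * F := ((xvar R)^-1 * (ker_c' / ker_a'), yvar R).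
Definition Psi : F * F := (xvar R, (yvar R)^-1 * (ker_c / ker_a)).

(** For a nondegenerate zero-drift model [Phi] and [Psi] are birational
    involutions, so the smallest such subgroup does exist. *)
Definition model_group : set (F * F) :=
  smallest (@birational_subgroup R) [set Phi; Psi].

End Group.

(* Main.v *)
(** Write A, C for the paper's a~, c~, and f = C/A, g = c/a, so that
    Phi(x, y) = (f(y)/x, y) and Psi(x, y) = (x, g(x)/y). Zero drift and
    sum i j p(i,j) = 0 give f = 1 + k (y-1)^2 / A(y) and
    g = 1 + l (x-1)^2 / a(x), so (1, 1) is a fixed point of both involutions and
    Phi Psi has differential -1 there. If k = 0 or l = 0, that is under one of
    the symmetries, one involution is an inversion, which commutes with the
    other because the quadratics defining the latter are palindromic. Otherwise,
    with u = x - 1 and v = y - 1, the square of Phi Psi moves x by the nonzero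
    cubic
      2 k l / (A(1) a(1)) u^2 v + 2 (k / A(1) - k A'(1) / A(1)^2) v^3
    modulo terms of order 4, and moves y by terms of order 3. Its n-th iterate
    moves x by n times that cubic modulo order 4, so the iterates are pairwise
    distinct. *)

Require Import Defs.
From HB Require Import structures.
From mathcomp Require Import all_boot all_order all_algebra.
From mathcomp Require Import generic_quotient polyXY fraction complex finmap.
From mathcomp Require Import classical_sets functions cardinality reals trigo.
From mathcomp Require Import ring lra.

Set Implicit Arguments.
Unset Strict Implicit.

Import Order.TTheory GRing.Theory Num.Theory.
Local Open Scope classical_set_scope.
Local Open Scope ring_scope.
Local Open Scope complex_scope.

(** * A local ring and its involutions *)

(* [M k] plays the role of the k-th power of the maximal ideal of a local ring
   with fraction field [L]. *)
Record filtration (L : fieldType) (M : nat -> L -> Prop) : Prop := Filtration {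
  fil0 : forall k, M k 0;
  filD : forall k z w, M k z -> M k w -> M k (z + w);
  filN : forall k z, M k z -> M k (- z);
  filM : forall i j z w, M i z -> M j w -> M (i + j)%N (z * w);
  filS : forall k z, M k.+1 z -> M k z;
  fil1 : M 0 1;
  filV : forall z, M 1 (z - 1) -> M 0 z^-1;
  fil_proper : ~ M 1 1
}.

Section Filtration.
Variables (L : fieldType) (M : nat -> L -> Prop) (fM : filtration M).

Lemma filB k z w : M k z -> M k w -> M k (z - w).
Proof. by move=> zM wM; apply: (filD fM) zM (filN fM wM). Qed.

Lemma filW i j z : (j <= i)%N -> M i z -> M j z.
Proof.
move=> /subnK <-; elim: (i - j)%N => // n IHn.
by rewrite addSn => /(filS fM).
Qed.

Lemma filMl k c z : M 0 c -> M k z -> M k (c * z).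
Proof. exact: (filM fM). Qed.

Lemma filMr k c z : M 0 c -> M k z -> M k (z * c).
Proof. by rewrite mulrC; apply: filMl. Qed.

Lemma filMn k z n : M k z -> M k (z *+ n).
Proof.
move=> zM; elim: n => [|n IHn]; first exact: (fil0 fM).
by rewrite mulrS; apply: (filD fM).
Qed.

Lemma filX z n : M 1 z -> M n (z ^+ n).
Proof.
move=> zM; elim: n => [|n IHn]; first exact: (fil1 fM).
by rewrite exprS -add1n; apply: (filM fM).
Qed.

Lemma fil_near1 z : M 1 (z - 1) -> M 0 z.
Proof.
by move=> zM; rewrite -(subrK 1 z); apply: (filD fM) (filS fM zM) (fil1 fM).
Qed.

Lemma fil_near1_neq0 z : M 1 (z - 1) -> z != 0.
Proof.
apply: contraPneq => ->; rewrite sub0r => /(filN fM).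
by rewrite opprK; apply: (fil_proper fM).
Qed.

End Filtration.

(** Expanded at 1: [A] is the value there and [B] the derivative. *)
Definition quadratic (L : fieldType) (A B D z : L) : L :=
  A + B * (z - 1) + D * (z - 1) ^+ 2.

(** Quotient of two quadratics with the same value and derivative at 1, whose leading coefficients
    [D + k] and [D] differ by [k]. *)
Definition bump_ratio (L : fieldType) (A B D k z : L) : L :=
  1 + k * (z - 1) ^+ 2 / quadratic A B D z.

(** * Taylor expansion of the quotient of quadratics at 1 *)

Section Expansion.
Variables (L : fieldType) (M : nat -> L -> Prop) (fM : filtration M).
Variables (A B D k : L).
Hypotheses (AM : M 0 A) (BM : M 0 B) (DM : M 0 D) (kM : M 0 k).
Hypotheses (A_neq0 : A != 0) (AVM : M 0 A^-1).

(** Divided by [A], whose inverse has order 0, the quadratic is 1 modulo [M 1]. *)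
Lemma quadratic_neq0 z : M 1 (z - 1) -> quadratic A B D z != 0.
Proof.
move=> zM; have : M 1 (quadratic A B D z / A - 1).
  have -> : quadratic A B D z / A - 1 = A^-1 * (B + D * (z - 1)) * (z - 1).
    by rewrite /quadratic; field.
  apply: (filMl fM _ zM); apply: (filMl fM) AVM _; apply: (filD fM) BM _.
  exact: (filMl fM) DM (filS fM zM).
by move=> /(fil_near1_neq0 fM); apply: contraNneq => ->; rewrite mul0r.
Qed.

Lemma fil_quadraticV z : M 1 (z - 1) -> M 0 (quadratic A B D z)^-1.
Proof.
move=> zM; have /(filV fM) : M 1 (quadratic A B D z / A - 1).
  have -> : quadratic A B D z / A - 1 = A^-1 * (B + D * (z - 1)) * (z - 1).
    by rewrite /quadratic; field.
  apply: (filMl fM _ zM); apply: (filMl fM) AVM _; apply: (filD fM) BM _.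
  exact: (filMl fM) DM (filS fM zM).
rewrite invf_div => /(filMl fM AVM); rewrite mulrA mulVf // mul1r.
by [].
Qed.

Lemma bump_ratio_near1 z : M 1 (z - 1) -> M 2 (bump_ratio A B D k z - 1).
Proof.
move=> zM; rewrite /bump_ratio addrC addKr.
apply: (filMr fM) (fil_quadraticV zM) _; apply: (filMl fM) kM _.
exact: filX.
Qed.

(** The subtracted polynomial is the Taylor polynomial of degree 3, and the remainder is an explicit
    regular multiple of [(z - 1) ^+ 4]. *)
Lemma bump_ratio_expansion z : M 1 (z - 1) ->
  M 4 (bump_ratio A B D k z
       - (1 + k / A * (z - 1) ^+ 2 - k * B / A ^+ 2 * (z - 1) ^+ 3)).
Proof.
move=> zM; have Qz := quadratic_neq0 zM; have QM := fil_quadraticV zM.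
have -> : bump_ratio A B D k z
       - (1 + k / A * (z - 1) ^+ 2 - k * B / A ^+ 2 * (z - 1) ^+ 3)
  = k / A ^+ 2 * (B * B - A * D + B * D * (z - 1))
      * (quadratic A B D z)^-1 * (z - 1) ^+ 4.
  move: Qz; rewrite /bump_ratio /quadratic => Qz; field.
  by rewrite Qz.
apply: (filMl fM); last exact: filX.
have z0 := filS fM zM.
apply: (filMl fM) QM; apply: (filMl fM).
  by apply: (filMl fM) kM _; rewrite expr2 invfM; apply: (filMl fM).
apply: (filD fM); last by apply: (filMl fM _ z0); apply: (filMl fM).
by apply: (filB fM); apply: (filMl fM).
Qed.

(** One order is gained because the expansion has no linear term. The bound on [i] reflects that the
    expansion is only known modulo order 4. *)
Lemma bump_ratio_sub i z w : M 1 (z - 1) -> M 1 (w - 1) -> (i < 4)%N ->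
  M i (z - w) -> M i.+1 (bump_ratio A B D k z - bump_ratio A B D k w).
Proof.
move=> zM wM i_lt4 zwM.
have := filB fM (bump_ratio_expansion zM) (bump_ratio_expansion wM).
move=> /(filW fM i_lt4) dM.
set fz := bump_ratio _ _ _ _ z in dM *; set fw := bump_ratio _ _ _ _ w in dM *.
have kAM : M 0 (k / A) by apply: (filMl fM).
have kBM : M 0 (k * B / A ^+ 2).
  apply: (filMl fM); first exact: (filMl fM).
  by rewrite expr2 invfM; apply: (filMl fM).
have -> : fz - fw =
   fz - (1 + k / A * (z - 1) ^+ 2 - k * B / A ^+ 2 * (z - 1) ^+ 3)
   - (fw - (1 + k / A * (w - 1) ^+ 2 - k * B / A ^+ 2 * (w - 1) ^+ 3))
   + (z - w) * (k / A * ((z - 1) + (w - 1))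
      - k * B / A ^+ 2 * ((z - 1) ^+ 2 + (z - 1) * (w - 1) + (w - 1) ^+ 2)).
  by move: (k / A) (k * B / A ^+ 2) => a b; ring.
apply: (filD fM) dM _; rewrite -addn1; apply: (filM fM) zwM _.
apply: (filB fM); first by apply: (filMl fM) kAM (filD fM zM wM).
apply: (filMl fM) kBM (filW fM (_ : 1 <= 2)%N _) => //.
apply: (filD fM); last exact: filX.
by apply: (filD fM); [apply: filX | apply: (filM fM) zM wM].
Qed.

End Expansion.

(** * The square of the product of the two involutions, near the fixed point *)

Section Round.
Variables (L : fieldType) (M : nat -> L -> Prop) (fM : filtration M).
Variables (A B D k A' B' D' l : L).
Hypotheses (AM : M 0 A) (BM : M 0 B) (DM : M 0 D) (kM : M 0 k).
Hypotheses (AM' : M 0 A') (BM' : M 0 B') (DM' : M 0 D') (lM : M 0 l).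
Hypotheses (A_neq0 : A != 0) (AVM : M 0 A^-1).
Hypotheses (A'_neq0 : A' != 0) (AVM' : M 0 A'^-1).
Local Notation f := (bump_ratio A B D k).
Local Notation g := (bump_ratio A' B' D' l).
Variables x y : L.
Hypotheses (xM : M 1 (x - 1)) (yM : M 1 (y - 1)).
Let y1 := y^-1 * g x.
Let x1 := x^-1 * f y1.
Let y2 := y1^-1 * g x1.
Let x2 := x1^-1 * f y2.

Let gx := bump_ratio_near1 fM BM' DM' lM A'_neq0 AVM' xM.
Let x_neq0 := fil_near1_neq0 fM xM.
Let y_neq0 := fil_near1_neq0 fM yM.
Let gx_neq0 := fil_near1_neq0 fM (filS fM gx).

(** Modulo order 3, the inverse of [y = 1 + v] is [1 - v + v ^+ 2]; multiplying it by [g x] only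
    adds the quadratic term of [g]. *)
Let y1M : M 3 (y1 - 1 + (y - 1) - (y - 1) ^+ 2 - l / A' * (x - 1) ^+ 2).
Proof.
have gE := bump_ratio_expansion fM AM' BM' DM' lM A'_neq0 AVM' xM.
set h := l / A'; set h3 := l * B' / A' ^+ 2 in gE.
have hM : M 0 h by apply: (filMl fM).
have h3M : M 0 h3.
  apply: (filMl fM); first exact: (filMl fM).
  by rewrite expr2 invfM; apply: (filMl fM).
have -> : y1 - 1 + (y - 1) - (y - 1) ^+ 2 - h * (x - 1) ^+ 2
  = y^-1 * (g x - (1 + h * (x - 1) ^+ 2 - h3 * (x - 1) ^+ 3)
      - h3 * (x - 1) ^+ 3
      - ((y - 1) ^+ 3 + h * ((x - 1) ^+ 2 * (y - 1)))).
  by rewrite /y1; field.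
apply: (filMl fM) (filV fM yM) _; apply: (filB fM).
  apply: (filB fM); first exact: (filS fM).
  by apply: (filMl fM) h3M _; apply: (filX fM).
apply: (filD fM); first exact: (filX fM).
apply: (filMl fM) hM _; apply: (filM fM (i := 2) (j := 1)) => //.
exact: (filX fM).
Qed.

Let y1M2 : M 2 (y1 - 1 + (y - 1)).
Proof.
have hM : M 0 (l / A') by apply: (filMl fM).
have -> : y1 - 1 + (y - 1)
  = y1 - 1 + (y - 1) - (y - 1) ^+ 2 - l / A' * (x - 1) ^+ 2
    + ((y - 1) ^+ 2 + l / A' * (x - 1) ^+ 2) by ring.
apply: (filD fM) (filS fM y1M) _.
by apply: (filD fM); [|apply: (filMl fM) hM _]; apply: (filX fM).
Qed.

Let y1M1 : M 1 (y1 - 1).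
Proof.
have -> : y1 - 1 = y1 - 1 + (y - 1) - (y - 1) by ring.
exact: (filB fM) (filS fM y1M2) yM.
Qed.

Let fy1 := bump_ratio_near1 fM BM DM kM A_neq0 AVM y1M1.
Let fy1_neq0 := fil_near1_neq0 fM (filS fM fy1).

Let x1M2 : M 2 (x1 - 1 + (x - 1)).
Proof.
have -> : x1 - 1 + (x - 1) = x^-1 * (f y1 - 1 + (x - 1) ^+ 2).
  by rewrite /x1; field.
by apply: (filMl fM) (filV fM xM) (filD fM fy1 _); apply: (filX fM).
Qed.

Let x1M1 : M 1 (x1 - 1).
Proof.
have -> : x1 - 1 = x1 - 1 + (x - 1) - (x - 1) by ring.
exact: (filB fM) (filS fM x1M2) xM.
Qed.

(** Here [y2] is [y * g x1 / g x], and [x1 - 1] is [- (x - 1)] modulo order 2. The quadratic term of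
    [g] does not see this sign, so [g x1] and [g x] agree modulo order 3. *)
Lemma round_snd : M 3 (y2 - y).
Proof.
have -> : y2 - y = y * (g x)^-1 * (g x1 - g x).
  by rewrite /y2 /y1; field; rewrite ?gx_neq0 ?y_neq0.
apply: (filMl fM).
  apply: (filMl fM) (fil_near1 fM yM) (filV fM (filS fM gx)).
have g2M := bump_ratio_expansion fM AM' BM' DM' lM A'_neq0 AVM'.
have := filB fM (g2M _ x1M1) (g2M _ xM).
set h := l / A'; set h3 := l * B' / A' ^+ 2 => /(filS fM) dM.
have hM : M 0 h by apply: (filMl fM).
have h3M : M 0 h3.
  apply: (filMl fM); first exact: (filMl fM).
  by rewrite expr2 invfM; apply: (filMl fM).
have -> : g x1 - g x = g x1 - (1 + h * (x1 - 1) ^+ 2 - h3 * (x1 - 1) ^+ 3)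
   - (g x - (1 + h * (x - 1) ^+ 2 - h3 * (x - 1) ^+ 3))
   + h * ((x1 - 1 + (x - 1)) * (x1 - 1 - (x - 1)))
   - h3 * ((x1 - 1) ^+ 3 - (x - 1) ^+ 3) by ring.
apply: (filB fM).
  apply: (filD fM) dM _; apply: (filMl fM) hM _.
  exact: (filM fM (i := 2) (j := 1)) x1M2 (filB fM x1M1 xM).
by apply: (filMl fM) h3M _; apply: (filB fM); apply: (filX fM).
Qed.

Let y2M1 : M 1 (y2 - 1).
Proof.
have -> : y2 - 1 = y2 - y + (y - 1) by ring.
by apply: (filD fM) _ yM; apply: (filW fM) round_snd.
Qed.

(** Here [x2] is [x * f y2 / f y1]. Modulo order 4, [y2] may be replaced by [y] in [f y2], and the
    cubic is the leading part of [f y - f y1]. *)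
Lemma round_fst : M 4 (x2 - x
  - ((k * l / (A * A')) * ((x - 1) ^+ 2 * (y - 1)) *+ 2
     + (k / A - k * B / A ^+ 2) * (y - 1) ^+ 3 *+ 2)).
Proof.
set v := y - 1; set u := x - 1.
pose e := y1 - 1 + v - v ^+ 2 - l / A' * u ^+ 2.
have eM : M 3 e by [].
have fE := bump_ratio_expansion fM AM BM DM kM A_neq0 AVM.
have yy : M 4 (f y2 - f y).
  exact: (bump_ratio_sub fM AM BM DM kM A_neq0 AVM y2M1 yM _ round_snd).
have hM : M 0 (l / A') by apply: (filMl fM).
set h := l / A' in e eM hM.
have kAM : M 0 (k / A) by apply: (filMl fM).
have kBM : M 0 (k * B / A ^+ 2).
  apply: (filMl fM); first exact: (filMl fM).
  by rewrite expr2 invfM; apply: (filMl fM).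
have -> : k * l / (A * A') = k / A * h.
  by rewrite /h; field; rewrite ?A_neq0 ?A'_neq0.
have := filB fM (fE _ yM) (fE _ y1M1).
move: kAM kBM; set a := k / A; set b := k * B / A ^+ 2; rewrite -/v => aM bM dM.
set w := y1 - 1 in dM.
(* With [w = s - v] and [s] of order 2, modulo order 4 the square of [w] is [v ^+ 2 - s * v *+ 2]
   and its cube is [- v ^+ 3]. *)
pose s := v ^+ 2 + h * u ^+ 2 + e.
have wE : w = s - v by rewrite /s /e -/w; ring.
have sM : M 2 s.
  apply: (filD fM) (filS fM eM); apply: (filD fM); first exact: (filX fM).
  by apply: (filMl fM) hM _; apply: (filX fM).
have vM0 : M 0 v by apply: (filS fM).
pose c := a * h * (u ^+ 2 * v) *+ 2 + (a - b) * v ^+ 3 *+ 2.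
have cE : M 4 (f y - f y1 - c).
  have -> : f y - f y1 - c
    = f y - (1 + a * v ^+ 2 - b * v ^+ 3)
      - (f y1 - (1 + a * w ^+ 2 - b * w ^+ 3))
      + a * (e * v *+ 2 - s * s) + b * (s * (w ^+ 2 - w * v + v ^+ 2)).
    by rewrite wE /c /s; ring.
  apply: (filD fM).
    apply: (filD fM) dM _; apply: (filMl fM) aM _; apply: (filB fM).
      by apply: filMn => //; apply: (filM fM (i := 3) (j := 1)).
    exact: (filM fM (i := 2) (j := 2)).
  apply: (filMl fM) bM _; apply: (filM fM (i := 2) (j := 2)) => //.
  apply: (filD fM); last exact: (filX fM).
  apply: (filB fM); first exact: (filX fM).
  exact: (filM fM (i := 1) (j := 1)).
have cM : M 3 c.
  have ahM : M 0 (a * h) by apply: (filMl fM).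
  apply: (filD fM); apply: filMn => //.
    apply: (filMl fM) ahM _.
    by apply: (filM fM (i := 2) (j := 1)) => //; apply: (filX fM).
  by apply: (filMl fM); [apply: (filB fM) | apply: (filX fM)].
have dfM : M 4 (f y2 - f y1 - c).
  have -> : f y2 - f y1 - c = f y2 - f y + (f y - f y1 - c) by ring.
  exact: (filD fM).
have dfM3 : M 3 (f y2 - f y1).
  rewrite -(subrK c (_ - _)); exact: (filD fM) (filS fM dfM) cM.
(* The factor [x / f y1] is 1 modulo order 1, so it alters the difference [f y2 - f y1], of order 3,
   only at order 4. *)
have -> : x2 - x - c
  = f y2 - f y1 - c + (f y1)^-1 * ((x - 1 - (f y1 - 1)) * (f y2 - f y1)).
  rewrite /x2 /x1; move: (f y1) (f y2) fy1_neq0 => F1 F2 F1n; field.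
  by rewrite ?F1n ?x_neq0.
apply: (filD fM) dfM _; apply: (filMl fM); first exact: (filV fM (filS fM fy1)).
apply: (filM fM (i := 1) (j := 3)) => //.
exact: (filB fM) xM (filS fM fy1).
Qed.

End Round.

(** * Substitution and algebraic independence *)

Section Substitution.
Variables (K L : fieldType) (c : {rmorphism K -> L}).
Implicit Types (z : L * L) (q : {poly {poly K}}) (s n d : {poly K}).

Definition eval1 (w : L) s : L := (map_poly c s).[w].

Lemma eval1_is_zmod_morphism w : zmod_morphism (eval1 w).
Proof. by move=> s s'; rewrite /eval1 rmorphB !hornerE. Qed.

Lemma eval1_is_monoid_morphism w : monoid_morphism (eval1 w).
Proof.
rewrite /eval1; split=> [|s s']; first by rewrite rmorph1 !hornerE.
by rewrite rmorphM !hornerM.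
Qed.

HB.instance Definition _ w :=
  GRing.isZmodMorphism.Build {poly K} L (eval1 w) (eval1_is_zmod_morphism w).
HB.instance Definition _ w :=
  GRing.isMonoidMorphism.Build {poly K} L (eval1 w)
    (eval1_is_monoid_morphism w).

Definition subst2 z q : L := (map_poly (map_poly c) q).[z.1, z.2].

Lemma subst2_is_zmod_morphism z : zmod_morphism (subst2 z).
Proof. by move=> q q'; rewrite /subst2 rmorphB !hornerE. Qed.

Lemma subst2_is_monoid_morphism z : monoid_morphism (subst2 z).
Proof.
rewrite /subst2; split=> [|q q']; first by rewrite rmorph1 !hornerE.
by rewrite rmorphM !hornerM.
Qed.

Lemma subst2B z q q' : subst2 z (q - q') = subst2 z q - subst2 z q'.
Proof. exact: subst2_is_zmod_morphism. Qed.

Lemma subst2M z q q' : subst2 z (q * q') = subst2 z q * subst2 z q'.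
Proof. exact: (subst2_is_monoid_morphism z).2. Qed.

Lemma subst2_1 z : subst2 z 1 = 1.
Proof. exact: (subst2_is_monoid_morphism z).1. Qed.

HB.instance Definition _ z :=
  GRing.isZmodMorphism.Build {poly {poly K}} L (subst2 z)
    (subst2_is_zmod_morphism z).
HB.instance Definition _ z :=
  GRing.isMonoidMorphism.Build {poly {poly K}} L (subst2 z)
    (subst2_is_monoid_morphism z).

Lemma subst2_polyC z s : subst2 z s%:P = eval1 z.2 s.
Proof. by rewrite /subst2 map_polyC hornerC. Qed.

Lemma subst2_swap z q : subst2 z q = subst2 (z.2, z.1) (swapXY q).
Proof. by rewrite /subst2 -swapXY_map horner2_swapXY. Qed.

Lemma subst2_map_polyC z s : subst2 z s^:P = eval1 z.1 s.
Proof. by rewrite subst2_swap swapXY_map_polyC subst2_polyC. Qed.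

Lemma subst2_const z a : subst2 z a%:P%:P = c a.
Proof. by rewrite subst2_polyC /eval1 map_polyC hornerC. Qed.

Lemma subst2X z : subst2 z 'X = z.1.
Proof. by rewrite /subst2 map_polyX hornerX hornerC. Qed.

Lemma subst2Y z : subst2 z 'Y = z.2.
Proof. by rewrite subst2_polyC /eval1 map_polyX hornerX. Qed.

Lemma subst2E z q :
  subst2 z q = \sum_(i < size q) eval1 z.2 q`_i * z.1 ^+ i.
Proof.
rewrite -[in LHS](coefK q) poly_def rmorph_sum; apply: eq_bigr => i _ /=.
by rewrite -mul_polyC rmorphM rmorphXn /= subst2X subst2_polyC.
Qed.

(** Used to recognise both the embedding into fractions and a substitution followed by another one
    as instances of [subst2]. *)
Lemma subst2_unique (phi : {rmorphism {poly {poly K}} -> L}) z :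
    (forall a, phi a%:P%:P = c a) -> phi 'X = z.1 -> phi 'Y = z.2 ->
  phi =1 subst2 z.
Proof.
move=> phiC phiX phiY; elim/poly_ind=> [|q s IHq]; first by rewrite !rmorph0.
rewrite !rmorphD !rmorphM /= IHq phiX subst2X; congr (_ + _).
elim/poly_ind: s => [|s a IHs]; first by rewrite !rmorph0.
by rewrite !(rmorphD, rmorphM) /= IHs phiC phiY subst2Y subst2_const.
Qed.

(** Algebraic independence over [K]: the point is generic, so no denominator vanishes at it. *)
Definition independent z := forall q, q != 0 -> subst2 z q != 0.

Lemma independent_swap z : independent z -> independent (z.2, z.1).
Proof.
move=> zI q q0; rewrite subst2_swap -surjective_pairing; apply: zI.
by rewrite swapXY_eq0.
Qed.

Lemma independent_eval2 z s : independent z -> s != 0 -> eval1 z.2 s != 0.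
Proof. by move=> zI s0; rewrite -subst2_polyC zI // polyC_eq0. Qed.

Lemma independent_eval1 z s : independent z -> s != 0 -> eval1 z.1 s != 0.
Proof. by move=> /independent_swap zI /(independent_eval2 zI). Qed.

Lemma independent_fst_neq0 z : independent z -> z.1 != 0.
Proof. by move=> zI; rewrite -subst2X zI // polyX_eq0. Qed.

Lemma independent_snd_neq0 z : independent z -> z.2 != 0.
Proof. by move=> /independent_swap /independent_fst_neq0. Qed.

(** Acts on points over [L]; its value at the generic point is the corresponding rational map. *)
Definition flip_fst n d z : L * L :=
  (z.1^-1 * (eval1 z.2 n / eval1 z.2 d), z.2).
Definition flip_snd n d z : L * L :=
  (z.1, z.2^-1 * (eval1 z.1 n / eval1 z.1 d)).

Lemma independent_flip_fst n d z : n != 0 -> d != 0 ->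
  independent z -> independent (flip_fst n d z).
Proof.
move=> n0 d0 zI q q0; rewrite /flip_fst.
pose N := (size q).-1.
have sz : size q = N.+1 by rewrite prednK // size_poly_gt0.
(* Clearing denominators turns [q (z.1^-1 * n / d, z.2)] into [P z]. *)
pose P := \poly_(j < N.+1) (q`_(N - j) * n ^+ (N - j) * d ^+ j).
have P0 : P != 0.
  (* The constant coefficient of [P] is the leading coefficient of [q] times [n ^+ N]. *)
  apply: contraNneq q0 => /(congr1 (fun r : {poly {poly K}} => r`_0)).
  rewrite coef_poly /= subn0 expr0 mulr1 coef0 => /eqP.
  by rewrite mulf_eq0 expf_eq0 (negPf n0) andbF orbF -lead_coefE lead_coef_eq0.
apply: contraNneq (zI _ P0) => q_eq0.
have ez : eval1 z.2 d != 0 by apply: independent_eval2.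
have z10 := independent_fst_neq0 zI.
suff -> : subst2 z P
    = subst2 (z.1^-1 * (eval1 z.2 n / eval1 z.2 d), z.2) q
      * (eval1 z.2 d * z.1) ^+ N by rewrite q_eq0 mul0r.
rewrite [X in _ = X * _]subst2E sz mulr_suml /P poly_def rmorph_sum.
rewrite (reindex_inj rev_ord_inj).
apply: eq_bigr => i _ /=.
rewrite subSS -mul_polyC rmorphM rmorphXn /= subst2X subst2_polyC.
have iN : (i <= N)%N by rewrite -ltnS.
rewrite subKn // !rmorphM !rmorphXn /=.
rewrite -[in X in _ = _ * _ ^+ X](subnK iN).
move: (z.1) z10 (eval1 z.2 d) ez (eval1 z.2 n) (eval1 z.2 q`_i).
move=> a a0 b b0 e r.
rewrite exprD !exprMn !exprVn.
have := expf_neq0 i a0; have := expf_neq0 i b0.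
move: (a ^+ i) (b ^+ i) => a' b' b'0 a'0.
by field; rewrite b'0 a'0.
Qed.

Lemma independent_flip_snd n d z : n != 0 -> d != 0 ->
  independent z -> independent (flip_snd n d z).
Proof.
move=> n0 d0 /independent_swap zI.
exact: independent_swap (independent_flip_fst n0 d0 zI).
Qed.

Lemma flip_fstK n d z : n != 0 -> d != 0 -> independent z ->
  flip_fst n d (flip_fst n d z) = z.
Proof.
move=> n0 d0 zI; rewrite /flip_fst /= [RHS]surjective_pairing.
have := independent_eval2 zI n0; have := independent_eval2 zI d0.
have := independent_fst_neq0 zI => z0 nz dz; congr pair; field.
by rewrite z0 nz dz.
Qed.

Lemma flip_sndK n d z : n != 0 -> d != 0 -> independent z ->
  flip_snd n d (flip_snd n d z) = z.
Proof.
move=> n0 d0 zI; rewrite /flip_snd /= [RHS]surjective_pairing.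
have := independent_eval1 zI n0; have := independent_eval1 zI d0.
have := independent_snd_neq0 zI => z0 nz dz; congr pair; field.
by rewrite z0 nz dz.
Qed.

End Substitution.

(** * The orbit of the generic point *)

Section LocalOrder.
Variables (K L : fieldType) (fr : {rmorphism {poly {poly K}} -> L}).
Hypothesis fr_inj : injective fr.
Variable a : K.

Definition curve : {poly K} := 1 + a%:P * ('X - 1%:P).

(* [r] is regular at (1, 1) and vanishes there to order [k] along the line
   x - 1 = a (y - 1), on which y serves as the parameter. *)
Definition order_ge k (r : L) : Prop := exists n d : {poly {poly K}},
  [/\ r = fr n / fr d, d.[curve].[1] != 0 & ('X - 1%:P) ^+ k %| n.[curve]].

Lemma fr_eq0 q : (fr q == 0) = (q == 0).
Proof. by rewrite -(rmorph0 fr) (inj_eq fr_inj). Qed.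

Lemma fr_curve_neq0 d : d.[curve].[1] != 0 -> fr d != 0.
Proof.
by apply: contraNneq => /eqP; rewrite fr_eq0 => /eqP->; rewrite !horner0.
Qed.

Lemma order_ge_poly k q : ('X - 1%:P) ^+ k %| q.[curve] -> order_ge k (fr q).
Proof.
by exists q, 1; rewrite rmorph1 divr1 !hornerE oner_eq0.
Qed.

(** The choice of fraction does not matter: a denominator that does not vanish at 1 along the line
    is coprime to ['X - 1]. *)
Lemma dvdp_order_ge k q : order_ge k (fr q) -> ('X - 1%:P) ^+ k %| q.[curve].
Proof.
case=> n [d [qE d1 nk]]; have d0 := fr_curve_neq0 d1.
have /fr_inj nE : fr n = fr (q * d) by rewrite rmorphM qE divfK.
move: nk; rewrite nE hornerM Gauss_dvdpl //.
by apply: coprimep_expl; rewrite coprimep_sym coprimep_XsubC /root.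
Qed.

(** Restriction to the line is multiplicative, so orders are measured by divisibility in one
    variable. *)
Lemma order_ge_filtration : filtration order_ge.
Proof.
split.
- move=> k; rewrite -(rmorph0 fr); apply: order_ge_poly.
  by rewrite horner0 dvdp0.
- move=> k _ _ [n [d [-> d1 nk]]] [n' [d' [-> d'1 n'k]]].
  exists (n * d' + n' * d), (d * d'); split.
  + by rewrite rmorphD !rmorphM addf_div // fr_curve_neq0.
  + by rewrite !hornerM mulf_neq0.
  + by rewrite hornerD !hornerM; apply: dvdp_add; apply: dvdp_mulr.
- move=> k _ [n [d [-> d1 nk]]]; exists (- n), d.
  by rewrite rmorphN mulNr hornerN dvdpNr.
- move=> i j _ _ [n [d [-> d1 nk]]] [n' [d' [-> d'1 n'k]]].
  exists (n * n'), (d * d'); split.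
  + by rewrite !rmorphM mulf_div.
  + by rewrite !hornerM mulf_neq0.
  + by rewrite hornerM exprD; apply: dvdp_mul.
- move=> k _ [n [d [-> d1 nk]]]; exists n, d; split=> //.
  by apply: dvdp_trans nk; rewrite exprS dvdp_mull.
- by rewrite -(rmorph1 fr); apply: order_ge_poly; rewrite expr0 dvd1p.
- move=> z [n [d [zE d1 nk]]]; have d0 := fr_curve_neq0 d1.
  (* With [z - 1 = n / d], the inverse of [z] is [d / (n + d)], and [n] vanishes at (1, 1) while [d]
     does not. *)
  exists d, (n + d); split; last by rewrite expr0 dvd1p.
  + by rewrite -invf_div; congr _^-1; rewrite -(subrK 1 z) zE rmorphD; field.
  + move: nk; rewrite expr1 dvdp_XsubCl => /rootP n1.
    by rewrite hornerD hornerD n1 add0r.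
- rewrite -(rmorph1 fr) => /dvdp_order_ge; rewrite hornerC expr1 dvdp_XsubCl.
  by rewrite /root hornerC oner_eq0.
Qed.

Lemma order_ge_const b : order_ge 0 (fr b%:P%:P).
Proof. by apply: order_ge_poly; rewrite expr0 dvd1p. Qed.

Lemma order_ge_x : order_ge 1 (fr 'X - 1).
Proof.
rewrite -(rmorph1 fr) -rmorphB; apply: order_ge_poly.
have -> : ('X - 1).[curve] = a%:P * ('X - 1%:P).
  by rewrite !hornerE /curve; ring.
exact: dvdp_mull.
Qed.

Lemma order_ge_y : order_ge 1 (fr 'Y - 1).
Proof.
by rewrite -(rmorph1 fr) -rmorphB; apply: order_ge_poly; rewrite !hornerE.
Qed.

End LocalOrder.

(** The shape of the leading term in the displacement of x. *)
Definition cubic (K : fieldType) (c1 c2 : K) : {poly {poly K}} :=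
  (c1%:P%:P * (('X - 1) ^+ 2 * ('Y - 1))) *+ 2
  + (c2%:P%:P * ('Y - 1) ^+ 3) *+ 2.

Lemma cubic_curve (K : fieldType) (a c1 c2 : K) :
  (cubic c1 c2).[curve a] = ((c1 * a ^+ 2 + c2) *+ 2)%:P * ('X - 1%:P) ^+ 3.
Proof.
rewrite /cubic.
rewrite !(hornerD, hornerM, hornerMn, hornerC, hornerX, hornerN, horner_exp).
by rewrite /curve polyCMn polyCD polyCM polyC_exp polyC1; ring.
Qed.

Lemma rmorph_cubic (K L : fieldType) (fr : {rmorphism {poly {poly K}} -> L})
    (c1 c2 : K) : fr (cubic c1 c2) =
  (fr c1%:P%:P * ((fr 'X - 1) ^+ 2 * (fr 'Y - 1))) *+ 2
  + (fr c2%:P%:P * (fr 'Y - 1) ^+ 3) *+ 2.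
Proof.
rewrite /cubic rmorphD !rmorphMn; congr (_ *+ 2 + _ *+ 2).
  by rewrite !rmorphM !rmorphB !rmorph1.
by rewrite !rmorphM !rmorphB !rmorph1.
Qed.

(** * Drift of the iterates of the generic point *)

Section Drift.
Variables (K L : fieldType) (fr : {rmorphism {poly {poly K}} -> L}).
Hypothesis fr_inj : injective fr.
Hypothesis K_char0 : forall m, m.+1%:R != 0 :> K.
Local Notation c := (fr \o (polyC \o polyC)).
Variables (A B D k A' B' D' l : K).
Hypotheses (A0 : A != 0) (A'0 : A' != 0) (k0 : k != 0) (l0 : l != 0).

Definition taylor2 (b0 b1 b2 : K) : {poly K} :=
  b0%:P + b1%:P * ('X - 1%:P) + b2%:P * ('X - 1%:P) ^+ 2.

Lemma eval1_taylor2 w b0 b1 b2 :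
  eval1 c w (taylor2 b0 b1 b2) = quadratic (c b0) (c b1) (c b2) w.
Proof.
rewrite /taylor2 /quadratic !(rmorphD, rmorphM, rmorphXn, rmorphN) /=.
have E b : eval1 c w b%:P = c b by rewrite /eval1 map_polyC hornerC.
by rewrite !E /eval1 map_polyX hornerX /= !rmorph1.
Qed.

Lemma taylor2_neq0 b0 b1 b2 : b0 != 0 -> taylor2 b0 b1 b2 != 0.
Proof.
apply: contraNneq => /(congr1 (horner^~ 1)).
by rewrite /taylor2 !hornerE subrr /= !(mulr0, mul0r, addr0) => ->.
Qed.

Local Notation step z :=
  (flip_fst c (taylor2 A B (D + k)) (taylor2 A B D)
    (flip_snd c (taylor2 A' B' (D' + l)) (taylor2 A' B' D') z)).

Lemma eval1_ratio w b0 b1 b2 e : eval1 c w (taylor2 b0 b1 b2) != 0 ->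
  eval1 c w (taylor2 b0 b1 (b2 + e)) / eval1 c w (taylor2 b0 b1 b2)
  = bump_ratio (c b0) (c b1) (c b2) (c e) w.
Proof.
rewrite !eval1_taylor2 /bump_ratio => q0.
have -> : quadratic (c b0) (c b1) (c (b2 + e)) w
    = quadratic (c b0) (c b1) (c b2) w + c e * (w - 1) ^+ 2.
  by rewrite /quadratic rmorphD; ring.
by rewrite mulrDl divff.
Qed.

(** The step is taken twice because its differential at (1, 1) is -1; its square is tangent to the
    identity. *)
Definition flip_orbit n : L * L :=
  iter n (fun z => step (step z)) (fr 'X, fr 'Y).

Lemma independent_step z : independent c z -> independent c (step z).
Proof.
by move=> zI; apply: independent_flip_fst; rewrite ?taylor2_neq0 //;
  apply: independent_flip_snd; rewrite ?taylor2_neq0.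
Qed.

Lemma independent_var : independent c (fr 'X, fr 'Y).
Proof.
move=> q q0; rewrite -(@subst2_unique _ _ c fr) // -(rmorph0 fr).
by rewrite (inj_eq fr_inj).
Qed.

Lemma independent_orbit n : independent c (flip_orbit n).
Proof.
elim: n => [|n IHn]; first exact: independent_var.
by do 2!apply: independent_step.
Qed.

Definition drift1 := k * l / (A * A').
Definition drift2 := k / A - k * B / A ^+ 2.
Local Notation drift := (fr (cubic drift1 drift2)).

Lemma driftE : drift =
  (c k * c l / (c A * c A')) * ((fr 'X - 1) ^+ 2 * (fr 'Y - 1)) *+ 2
  + (c k / c A - c k * c B / c A ^+ 2) * (fr 'Y - 1) ^+ 3 *+ 2.
Proof.
rewrite rmorph_cubic; congr (_ * _ *+ 2 + _ * _ *+ 2).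
  by transitivity (c drift1) => //; rewrite /drift1 fmorph_div !rmorphM.
transitivity (c drift2) => //.
by rewrite /drift2 rmorphB !fmorph_div rmorphM rmorphXn.
Qed.

(** Independence of [z] and of its image under the first flip keeps both denominators nonzero. *)
Lemma step_bump z : independent c z ->
  step z = (z.1^-1 * bump_ratio (c A) (c B) (c D) (c k)
                       (z.2^-1 * bump_ratio (c A') (c B') (c D') (c l) z.1),
            z.2^-1 * bump_ratio (c A') (c B') (c D') (c l) z.1).
Proof.
move=> zI.
have z1I : independent c
    (flip_snd c (taylor2 A' B' (D' + l)) (taylor2 A' B' D') z).
  by apply: independent_flip_snd; rewrite ?taylor2_neq0.
have gz : eval1 c z.1 (taylor2 A' B' D') != 0.
  by apply: independent_eval1; rewrite ?taylor2_neq0.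
have := independent_eval2 z1I (taylor2_neq0 B D A0).
by rewrite /flip_fst /flip_snd /= (eval1_ratio l gz) => /eval1_ratio->.
Qed.

(* Along the line of slope [a] the leading coefficient of the drift is twice
   [drift1 * a ^+ 2 + drift2], which cannot vanish at both [a = 0] and
   [a = 1]. *)
Definition slope : K := (drift2 == 0)%:R.
Local Notation M := (order_ge fr slope).
Let fM := order_ge_filtration fr_inj slope.

Lemma drift_not_order4 : ~ M 4 drift.
Proof.
move=> /(dvdp_order_ge fr_inj); rewrite cubic_curve.
(* After cancelling [('X - 1) ^+ 3], a constant would be divisible by ['X - 1], hence zero. *)
rewrite exprS dvdp_mul2r ?expf_neq0 ?polyXsubC_eq0 // dvdp_XsubCl.
rewrite /root hornerC -mulr_natr mulf_eq0 (negPf (K_char0 1)) orbF.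
apply/negP; rewrite /slope; have [->|d0] := eqVneq drift2 0.
  rewrite expr1n mulr1 addr0 /drift1 !mulf_eq0 invr_eq0 mulf_eq0.
  by rewrite (negPf k0) (negPf l0) (negPf A0) (negPf A'0).
by rewrite expr0n mulr0 add0r.
Qed.

Let cM b : M 0 (c b). Proof. exact: order_ge_const. Qed.
Let cVM b : M 0 (c b)^-1. Proof. rewrite -fmorphV; exact: cM. Qed.
Let c_neq0 b : b != 0 -> c b != 0. Proof. by rewrite fmorph_eq0. Qed.

Lemma drift_order3 : M 3 drift.
Proof.
apply: order_ge_poly; rewrite cubic_curve; exact: dvdp_mull.
Qed.

(** By induction: the n-th point agrees with the generic one modulo order 3, so the cubic takes the
    same value at both modulo order 4, and each round adds the same drift. *)
Lemma orbit_expansion n :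
  M 4 ((flip_orbit n).1 - fr 'X - drift *+ n) /\ M 3 ((flip_orbit n).2 - fr 'Y).
Proof.
elim: n => [|n [IHx IHy]].
  by rewrite /= mulr0n subr0 !subrr; split; apply: (fil0 fM).
have zI := independent_orbit n; rewrite [flip_orbit _]iterS -/(flip_orbit n).
move: (flip_orbit n) zI IHx IHy => z zI IHx IHy.
have uM := order_ge_x fr slope; have vM := order_ge_y fr slope.
have x3 : M 3 (z.1 - fr 'X).
  rewrite -(subrK (drift *+ n) (_ - _)); apply: (filD fM) (filS fM IHx) _.
  exact: (filMn fM) drift_order3.
have xM : M 1 (z.1 - 1).
  have -> : z.1 - 1 = z.1 - fr 'X + (fr 'X - 1) by ring.
  by apply: (filD fM) _ uM; apply: (filW fM _ x3).
have yM : M 1 (z.2 - 1).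
  have -> : z.2 - 1 = z.2 - fr 'Y + (fr 'Y - 1) by ring.
  by apply: (filD fM) _ vM; apply: (filW fM _ IHy).
have := round_fst fM (cM A) (cM B) (cM D) (cM k) (cM A') (cM B') (cM D') (cM l)
  (c_neq0 A0) (cVM A) (c_neq0 A'0) (cVM A') xM yM.
have := round_snd fM (cM B) (cM D) (cM k) (cM A') (cM B') (cM D') (cM l)
  (c_neq0 A0) (cVM A) (c_neq0 A'0) (cVM A') xM yM.
rewrite (step_bump (independent_step zI)) (step_bump zI) /=.
set y2 := (X in X - z.2); set x2 := (X in X - z.1) => y2M x2M.
split; last first.
  have -> : y2 - fr 'Y = y2 - z.2 + (z.2 - fr 'Y) by ring.
  exact: (filD fM).
move: x2M; set h1 := _ / (_ * _); set h2 := _ / _ - _ / _.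
move=> x2M.
(* The last summand is the cubic at [z] minus the cubic at the generic point. Each of its terms has
   a coordinate difference of order 3 times a factor of order 2, so it has order 5. *)
have -> : x2 - fr 'X - drift *+ n.+1
  = (z.1 - fr 'X - drift *+ n)
    + (x2 - z.1 - (h1 * ((z.1 - 1) ^+ 2 * (z.2 - 1)) *+ 2
                   + h2 * (z.2 - 1) ^+ 3 *+ 2))
    + (h1 * ((z.1 - fr 'X) * ((z.1 - 1 + (fr 'X - 1)) * (z.2 - 1))
             + (fr 'X - 1) ^+ 2 * (z.2 - fr 'Y))
       + h2 * ((z.2 - fr 'Y) * ((z.2 - 1) ^+ 2 + (z.2 - 1) * (fr 'Y - 1)
                                + (fr 'Y - 1) ^+ 2))) *+ 2.
  rewrite mulrS [X in _ - (X + _)]driftE -/h1 -/h2.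
  by move: (drift *+ n) => dn; ring.
have h1M : M 0 h1.
  by rewrite /h1 invfM; do 2!apply: (filMl fM); do ?[exact: cM | exact: cVM].
have h2M : M 0 h2.
  apply: (filB fM); first exact: (filMl fM) (cM k) (cVM A).
  rewrite /h2 expr2 invfM; do 2!apply: (filMl fM); do ?[exact: cM | exact: cVM].
apply: (filD fM); first exact: (filD fM).
apply: (filMn fM); apply: (filD fM).
  apply: (filMl fM) h1M _; apply: (filD fM).
    apply: (filS fM); apply: (filM fM (i := 3) (j := 2) x3).
    by apply: (filM fM (i := 1) (j := 1)) yM; apply: (filD fM).
  apply: (filS fM); apply: (filM fM (i := 2) (j := 3)) => //.
  exact: (filX fM).
apply: (filMl fM) h2M _; apply: (filS fM).
apply: (filM fM (i := 3) (j := 2)) => //.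
apply: (filD fM); last exact: (filX fM).
by apply: (filD fM); [exact: (filX fM) | apply: (filM fM (i := 1) (j := 1))].
Qed.

(** If points [m < n] coincided, [n - m] times the drift would have order 4. In characteristic 0 so
    would the drift itself, against [drift_not_order4]. *)
Lemma orbit_inj : injective flip_orbit.
Proof.
suff lt_neq m n : (m < n)%N -> flip_orbit m <> flip_orbit n.
  move=> m n mn; case: (ltngtP m n) => // lt_mn.
    by case: (lt_neq _ _ lt_mn mn).
  by case: (lt_neq _ _ lt_mn (esym mn)).
move=> lt_mn mn; apply: drift_not_order4.
have := filB fM (orbit_expansion m).1 (orbit_expansion n).1.
rewrite mn; set e := _ - _ - _.
have -> : e = drift *+ (n - m).
  rewrite /e (mulrnBr _ (ltnW lt_mn)).
  by move: (_ *+ m) (_ *+ n) => dm dn; ring.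
have -> : (n - m = (n - m).-1.+1)%N by rewrite prednK // subn_gt0.
move: (n - m).-1 => j jM.
have -> : drift = c j.+1%:R^-1 * (drift *+ j.+1).
  rewrite -[drift *+ _]mulr_natr mulrCA -(rmorph_nat c) -rmorphM mulVf //.
  by rewrite rmorph1 mulr1.
exact: (filMl fM) (cM _) jM.
Qed.

End Drift.

(** * Composition of rational maps *)

(* [fr], [c] and [rs] stand for [frac_of], [const_rat] and [rat_subst]: with an
   abstract field [L], unification cannot unfold the fraction field. *)
Section Composition.
Variables (K L : fieldType) (fr : {rmorphism {poly {poly K}} -> L}).
Variables (c : {rmorphism K -> L}) (frC : forall b, fr b%:P%:P = c b).
Variable rs : L -> L * L -> L.
Hypothesis fr_inj : injective fr.
Hypothesis fr_surj :
  forall r, exists n d : {poly {poly K}}, d != 0 /\ r = fr n / fr d.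
Hypothesis rsE : forall (n d : {poly {poly K}}) h, independent c h -> d != 0 ->
  rs (fr n / fr d) h = subst2 c h n / subst2 c h d.
Implicit Types (f g h z : L * L).

Definition rcomp f g := (rs f.1 g, rs f.2 g).
Definition rid : L * L := (fr 'X, fr 'Y).

Lemma subst2_rid q : subst2 c rid q = fr q.
Proof. by rewrite -(@subst2_unique _ _ c fr _ frC). Qed.

Lemma independent_rid : independent c rid.
Proof.
move=> q; apply: contraNneq => /eqP.
by rewrite subst2_rid -(rmorph0 fr) (inj_eq fr_inj) => /eqP->.
Qed.

Section Hom.
Variables (h : L * L) (hI : independent c h).

Lemma rs_fr q : rs (fr q) h = subst2 c h q.
Proof.
by have := rsE q hI (oner_neq0 _); rewrite !(rmorph1, subst2_1) !divr1.
Qed.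

Let frN0 (d : {poly {poly K}}) : d != 0 -> fr d != 0.
Proof. by rewrite -(rmorph0 fr) (inj_eq fr_inj). Qed.

(** Independence of [h] lets substitution extend from polynomials to their fractions; with the next
    lemma it becomes a field morphism. *)
Lemma rs_is_zmod_morphism : zmod_morphism (rs^~ h).
Proof.
move=> r r'; have [n [d [d0 ->]]] := fr_surj r.
have [n' [d' [d'0 ->]]] := fr_surj r'.
have -> : fr n / fr d - fr n' / fr d' = fr (n * d' - n' * d) / fr (d * d').
  rewrite -mulNr -rmorphN addf_div ?frN0 //.
  by rewrite -!(rmorphM fr) -(rmorphD fr) mulNr.
rewrite !rsE ?mulf_neq0 //.
rewrite subst2B !subst2M.
have := hI d0; have := hI d'0.
move: (subst2 c h n) (subst2 c h n') (subst2 c h d) (subst2 c h d').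
by move=> s1 s2 s3 s4 s40 s30; field; rewrite s30 s40.
Qed.

Lemma rs_is_monoid_morphism : monoid_morphism (rs^~ h).
Proof.
split=> [|r r']; first by rewrite -(rmorph1 fr) rs_fr subst2_1 rmorph1.
have [n [d [d0 ->]]] := fr_surj r; have [n' [d' [d'0 ->]]] := fr_surj r'.
rewrite mulf_div -!(rmorphM fr) !rsE ?mulf_neq0 //.
by rewrite !subst2M mulf_div.
Qed.

(** A name to which the morphism structures can be attached. *)
Definition rs_hom : L -> L := rs^~ h.
HB.instance Definition _ := GRing.isZmodMorphism.Build L L rs_hom
  rs_is_zmod_morphism.
HB.instance Definition _ := GRing.isMonoidMorphism.Build L L rs_hom
  rs_is_monoid_morphism.

(** Both sides are ring morphisms in [q] that agree on constants and on the two variables. *)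
Lemma rs_subst2 f q : rs (subst2 c f q) h = subst2 c (rcomp f h) q.
Proof.
rewrite -[LHS]/((rs_hom \o subst2 c f) q); apply: subst2_unique => [b||] /=.
- by rewrite subst2_const /rs_hom -frC rs_fr subst2_const.
- by rewrite subst2X.
- by rewrite subst2Y.
Qed.

Lemma rs_eval1 n w : rs (eval1 c w n) h = eval1 c (rs w h) n.
Proof. by rewrite -(subst2_polyC c (w, w)) rs_subst2 subst2_polyC. Qed.

Lemma rcomp_idl : rcomp rid h = h.
Proof. by rewrite /rcomp !rs_fr subst2X subst2Y -surjective_pairing. Qed.

(** Substituting [h] is a field morphism fixing the constants, so it commutes with the rational
    formula of the flip. *)
Lemma rcomp_flip_fst n d z :
  rcomp (flip_fst c n d z) h = flip_fst c n d (rcomp z h).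
Proof.
rewrite /rcomp /flip_fst /=; congr pair.
rewrite -[LHS]/(rs_hom _) rmorphM fmorphV fmorph_div; congr (_ * (_ / _)).
  exact: rs_eval1.
exact: rs_eval1.
Qed.

Lemma rcomp_flip_snd n d z :
  rcomp (flip_snd c n d z) h = flip_snd c n d (rcomp z h).
Proof.
rewrite /rcomp /flip_snd /=; congr pair.
rewrite -[LHS]/(rs_hom _) rmorphM fmorphV fmorph_div; congr (_ * (_ / _)).
  exact: rs_eval1.
exact: rs_eval1.
Qed.

(** Each component of [g] is a fraction, whose denominator stays nonzero at [f] and at the
    composite. *)
Lemma rcompA g f : independent c f -> independent c (rcomp f h) ->
  rcomp (rcomp g f) h = rcomp g (rcomp f h).
Proof.
move=> fI fhI; rewrite /rcomp /=; congr pair.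
  have [n [d [d0 ->]]] := fr_surj g.1; rewrite !rsE //.
  by rewrite -[LHS]/(rs_hom _) fmorph_div /= /rs_hom !rs_subst2.
have [n [d [d0 ->]]] := fr_surj g.2; rewrite !rsE //.
by rewrite -[LHS]/(rs_hom _) fmorph_div /= /rs_hom !rs_subst2.
Qed.

End Hom.

Lemma rcomp_idr f : rcomp f rid = f.
Proof.
rewrite /rcomp [RHS]surjective_pairing; congr pair.
  have [n [d [d0 ->]]] := fr_surj f.1.
  by rewrite rsE ?subst2_rid //; apply: independent_rid.
have [n [d [d0 ->]]] := fr_surj f.2.
by rewrite rsE ?subst2_rid //; apply: independent_rid.
Qed.

Definition rinverse f g := rcomp f g = rid /\ rcomp g f = rid.

Definition rsubgroup (G : set (L * L)) : Prop :=
  [/\ G `<=` [set f | exists g, rinverse f g],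
      G rid,
      forall f g, G f -> G g -> G (rcomp f g)
    & forall f g, G f -> rinverse f g -> G g].

(** * The four-group generated by two commuting involutions *)

Section KleinFour.
Variables f g : L * L.
Hypotheses (fI : independent c f) (gI : independent c g).
Hypotheses (fgI : independent c (rcomp f g)).
Hypotheses (ff : rcomp f f = rid) (gg : rcomp g g = rid).
Hypothesis fg : rcomp f g = rcomp g f.
Let h := rcomp f g.
Definition klein4 : set (L * L) := [set z | z \in [:: rid; f; g; h]].

Let klein_independent z : klein4 z -> independent c z.
Proof.
rewrite /klein4 /= !inE => /or4P[] /eqP-> //; exact: independent_rid.
Qed.

(** This and the next four facts complete the multiplication table. *)
Let fh : rcomp f h = g.
Proof. by rewrite /h -rcompA // ff; apply: rcomp_idl. Qed.

Let gh : rcomp g h = f.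
Proof. by rewrite /h fg -rcompA -?fg // gg; apply: rcomp_idl. Qed.

Let hf : rcomp h f = g.
Proof. by rewrite /h fg rcompA ?ff ?rcomp_idr //; apply: independent_rid. Qed.

Let hg : rcomp h g = f.
Proof. by rewrite /h rcompA ?gg ?rcomp_idr //; apply: independent_rid. Qed.

Let hh : rcomp h h = rid.
Proof. by rewrite {1}/h rcompA // ?gh //. Qed.

Let klein_involutive z : klein4 z -> rcomp z z = rid.
Proof.
rewrite /klein4 /= !inE => /or4P[] /eqP-> //; exact: rcomp_idr.
Qed.

Lemma klein4_subgroup : rsubgroup klein4.
Proof.
split.
- by move=> z /klein_involutive zz; exists z.
- by rewrite /klein4 /= !inE eqxx.
- move=> z w zG wG; have wI := klein_independent wG.
  move: zG; rewrite {1}/klein4 /= !inE => /or4P[] /eqP->.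
  + by rewrite rcomp_idl.
  + move: wG; rewrite /klein4 /= !inE => /or4P[] /eqP->;
      rewrite ?rcomp_idr ?ff ?fh -/h ?eqxx ?orbT //.
  + move: wG; rewrite /klein4 /= !inE => /or4P[] /eqP->;
      rewrite ?rcomp_idr ?gg ?gh -?fg -/h ?eqxx ?orbT //.
  + move: wG; rewrite /klein4 /= !inE => /or4P[] /eqP->;
      rewrite ?rcomp_idr ?hf ?hg ?hh ?eqxx ?orbT //.
- move=> z w zG [zw wz]; have zI := klein_independent zG.
  have zz := klein_involutive zG.
  (* Associativity asks nothing of the left factor, so the usual uniqueness of inverses applies
     although [w] is not known to be independent. *)
  suff -> : w = z by [].
  rewrite -(rcomp_idr w) -zz -rcompA ?wz ?rcomp_idl //.
  by rewrite zz; apply: independent_rid.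
Qed.

Lemma klein4_smallest : smallest rsubgroup [set f; g] = klein4.
Proof.
apply/seteqP; split.
  apply: smallest_sub; first exact: klein4_subgroup.
  by move=> z [] ->; rewrite /klein4 /= !inE eqxx ?orbT.
move=> z zG G [[_ G1 Gm _] fgG].
have Gf : G f by apply: fgG; left.
have Gg : G g by apply: fgG; right.
move: zG; rewrite /klein4 /= !inE => /or4P[] /eqP-> //; exact: Gm.
Qed.

(** By the multiplication table, [h] equal to [rid], [f] or [g] would force [f = g], [g = rid] or
    [f = rid] respectively. *)
Lemma card_klein4 : f <> rid -> g <> rid -> f <> g -> (klein4 #= `I_4)%card.
Proof.
move=> f1 g1 fneg.
have uniq4 : uniq [:: rid; f; g; h].
  have h1 : h <> rid by move=> e; apply: fneg; rewrite -hg e rcomp_idl.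
  have hnf : h <> f by move=> e; apply: g1; rewrite -fh e ff.
  have hng : h <> g by move=> e; apply: f1; rewrite -gh e gg.
  rewrite /= !inE !negb_or !andbT.
  by do !(apply/andP; split); apply/eqP => // /esym.
have -> : klein4 = [set` [fset z in [:: rid; f; g; h]]%fset].
  by apply/seteqP; split=> z; rewrite /klein4 /= in_fset.
by apply/card_eq_fsetP; rewrite card_fseq undup_id.
Qed.

End KleinFour.

Lemma infinite_smallest f g (w : nat -> L * L) : injective w ->
    w 0 = rid ->
    (forall n, w n.+1 = rcomp f (rcomp g (rcomp f (rcomp g (w n))))) ->
  infinite_set (smallest rsubgroup [set f; g]).
Proof.
move=> w_inj w0 wS.
have wG n : smallest rsubgroup [set f; g] (w n).
  move=> G [[_ G1 Gm _] fgG].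
  have Gf : G f by apply: fgG; left.
  have Gg : G g by apply: fgG; right.
  by elim: n => [|n IHn]; rewrite ?w0 ?wS //; do 4!apply: (Gm) => //.
move=> /(finite_preimage (f := w) _) fin; apply: infinite_nat.
apply: sub_finite_set (fin _) => [n _|]; first exact: wG.
by move=> m n _ _; apply: w_inj.
Qed.

End Composition.

(** * Groups generated by two flips of the generic point *)

Section Flips.
Variables (K L : fieldType) (fr : {rmorphism {poly {poly K}} -> L}).
Local Notation c := (fr \o (polyC \o polyC)).
Variable rs : L -> L * L -> L.
Hypothesis fr_inj : injective fr.
Hypothesis fr_surj :
  forall r, exists n d : {poly {poly K}}, d != 0 /\ r = fr n / fr d.
Hypothesis rsE : forall (n d : {poly {poly K}}) h, independent c h -> d != 0 ->
  rs (fr n / fr d) h = subst2 c h n / subst2 c h d.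
Let frC b : fr b%:P%:P = c b. Proof. by []. Qed.
Local Notation rid := (rid fr).
Local Notation rcomp := (rcomp rs).
Let ridI : independent c rid := independent_rid frC fr_inj.

(** Turns words in the two maps into iterated formulas on points. *)
Lemma rcomp_flip_fst_rid n d z : independent c z ->
  rcomp (flip_fst c n d rid) z = flip_fst c n d z.
Proof.
move=> zI; rewrite (rcomp_flip_fst frC fr_inj fr_surj rsE zI).
by rewrite (rcomp_idl rsE zI).
Qed.

Lemma rcomp_flip_snd_rid n d z : independent c z ->
  rcomp (flip_snd c n d rid) z = flip_snd c n d z.
Proof.
move=> zI; rewrite (rcomp_flip_snd frC fr_inj fr_surj rsE zI).
by rewrite (rcomp_idl rsE zI).
Qed.

(** Otherwise [n - d * x ^+ 2] would vanish, a nontrivial relation between the two variables. *)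
Lemma flip_fst_rid_neq n d : d != 0 -> flip_fst c n d rid <> rid.
Proof.
move=> d0 /(congr1 fst) /= fE.
have dI := independent_eval2 ridI d0; have xI := independent_fst_neq0 ridI.
suff /eqP : subst2 c rid (n%:P - d%:P * 'X^2) = 0.
  apply/negP/ridI/eqP => /(congr1 (fun q : {poly {poly K}} => q`_2)).
  rewrite coefB coefC coefCM coefXn coef0 /= sub0r mulr1 => /eqP.
  by rewrite oppr_eq0 (negPf d0).
rewrite subst2B subst2M !subst2_polyC expr2 subst2M subst2X /=.
by rewrite -{1}fE; field; rewrite dI xI.
Qed.

Lemma flip_snd_rid_neq n d : d != 0 -> flip_snd c n d rid <> rid.
Proof.
move=> d0 /(congr1 snd) /= fE.
have dI := independent_eval1 ridI d0; have yI := independent_snd_neq0 ridI.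
suff /eqP : subst2 c rid (swapXY (n%:P - d%:P * 'X^2)) = 0.
  apply/negP/ridI; rewrite swapXY_eq0.
  apply/eqP => /(congr1 (fun q : {poly {poly K}} => q`_2)).
  rewrite coefB coefC coefCM coefXn coef0 /= sub0r mulr1 => /eqP.
  by rewrite oppr_eq0 (negPf d0).
rewrite subst2_swap swapXYK subst2B subst2M !subst2_polyC.
rewrite expr2 subst2M subst2X /=.
by rewrite -{1}fE; field; rewrite dI yI.
Qed.

Lemma card_flip_group n d n' d' : n != 0 -> d != 0 -> n' != 0 -> d' != 0 ->
    flip_fst c n d (flip_snd c n' d' rid)
    = flip_snd c n' d' (flip_fst c n d rid) ->
  (smallest (rsubgroup fr rs) [set flip_fst c n d rid; flip_snd c n' d' rid]
     #= `I_4)%card.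
Proof.
move=> n0 d0 n'0 d'0 comm.
set f := flip_fst c n d rid; set g := flip_snd c n' d' rid.
have fI : independent c f by apply: independent_flip_fst.
have gI : independent c g by apply: independent_flip_snd.
have ff : rcomp f f = rid by rewrite rcomp_flip_fst_rid // flip_fstK.
have gg : rcomp g g = rid by rewrite rcomp_flip_snd_rid // flip_sndK.
have fg : rcomp f g = rcomp g f.
  by rewrite rcomp_flip_fst_rid // rcomp_flip_snd_rid.
have fgI : independent c (rcomp f g).
  by rewrite rcomp_flip_fst_rid //; apply: independent_flip_fst.
rewrite (klein4_smallest frC fr_inj fr_surj rsE fI gI fgI ff gg fg).
apply: (card_klein4 frC fr_inj fr_surj rsE fI gI fgI ff gg fg).
- exact: flip_fst_rid_neq.
- exact: flip_snd_rid_neq.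
(* The map [f] keeps y and [g] keeps x, so [f = g] would make [g] the identity. *)
- move=> e; apply: (@flip_snd_rid_neq n' d' d'0).
  by rewrite [LHS]surjective_pairing -/g -{2}e.
Qed.

Definition palindrome (a b : K) : {poly K} := a%:P + b%:P * 'X + a%:P * 'X^2.

Lemma eval1_palindrome w a b :
  eval1 c w (palindrome a b) = c a + c b * w + c a * w ^+ 2.
Proof.
rewrite /palindrome !(rmorphD, rmorphM, rmorphXn) /=.
have E e : eval1 c w e%:P = c e by rewrite /eval1 map_polyC hornerC.
by rewrite !E /eval1 map_polyX hornerX.
Qed.

(** Inverting the variable divides a palindromic quadratic by [w ^+ 2], which cancels in the
    quotient. *)
Lemma palindrome_ratioV w a b a' b' : w != 0 ->
  eval1 c w^-1 (palindrome a b) / eval1 c w^-1 (palindrome a' b')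
  = eval1 c w (palindrome a b) / eval1 c w (palindrome a' b').
Proof.
move=> w0; have E e e' :
    eval1 c w^-1 (palindrome e e') = eval1 c w (palindrome e e') / w ^+ 2.
  by rewrite !eval1_palindrome; field; rewrite w0.
rewrite !E; move: (w ^+ 2) (expf_neq0 2 w0) => w2 w2_neq0.
by rewrite invfM invrK mulrACA mulVf // mulr1.
Qed.

(** With [n' = d'] the second flip is the inversion of y, under which a quotient of palindromic
    quadratics in y is invariant; hence the flips commute. *)
Lemma card_flip_group_north_south a b a' b' n d n' d' :
    n = palindrome a b -> d = palindrome a' b' -> n' = d' ->
    n != 0 -> d != 0 -> d' != 0 ->
  (smallest (rsubgroup fr rs) [set flip_fst c n d rid; flip_snd c n' d' rid]
     #= `I_4)%card.
Proof.
move=> nE dE -> n0 d0 n'0; apply: card_flip_group => //.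
have fI : independent c (flip_fst c n d rid) by apply: independent_flip_fst.
have y0 := independent_snd_neq0 ridI.
have n'f := independent_eval1 fI n'0; have n'r := independent_eval1 ridI n'0.
rewrite /flip_snd !divff // !mulr1; congr pair.
by rewrite /flip_fst /= nE dE palindrome_ratioV.
Qed.

Lemma card_flip_group_east_west a b a' b' n d n' d' :
    n' = palindrome a b -> d' = palindrome a' b' -> n = d ->
    n' != 0 -> d' != 0 -> d != 0 ->
  (smallest (rsubgroup fr rs) [set flip_fst c n d rid; flip_snd c n' d' rid]
     #= `I_4)%card.
Proof.
move=> n'E d'E -> n'0 d'0 n0; apply: card_flip_group => //.
have gI : independent c (flip_snd c n' d' rid) by apply: independent_flip_snd.
have x0 := independent_fst_neq0 ridI.
have ng := independent_eval2 gI n0; have nr := independent_eval2 ridI n0.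
rewrite /flip_fst !divff // !mulr1; congr pair.
by rewrite /flip_snd /= n'E d'E palindrome_ratioV.
Qed.

(** The points of [flip_orbit] are the powers of the square of the product of the two flips, and
    [orbit_inj] separates them. *)
Lemma infinite_flip_group A B D k A' B' D' l n d n' d' :
    n = taylor2 A B (D + k) -> d = taylor2 A B D ->
    n' = taylor2 A' B' (D' + l) -> d' = taylor2 A' B' D' ->
    (forall m, m.+1%:R != 0 :> K) -> A != 0 -> A' != 0 -> k != 0 -> l != 0 ->
  infinite_set (smallest (rsubgroup fr rs)
    [set flip_fst c n d rid; flip_snd c n' d' rid]).
Proof.
move=> -> -> -> -> K0 A0 A'0 k0 l0.
have oI := independent_orbit fr_inj B D k B' D' l A0 A'0.
apply: (infinite_smallest (w := flip_orbit fr A B D k A' B' D' l)) => //.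
  exact: orbit_inj.
move=> m; rewrite [LHS]iterS -/(flip_orbit fr A B D k A' B' D' l m).
move: (flip_orbit _ _ _ _ _ _ _ _ _ m) (oI m) => z zI.
have fI w : independent c w ->
    independent c (flip_fst c (taylor2 A B (D + k)) (taylor2 A B D) w).
  by apply: independent_flip_fst; apply: taylor2_neq0.
have gI w : independent c w ->
    independent c (flip_snd c (taylor2 A' B' (D' + l)) (taylor2 A' B' D') w).
  by apply: independent_flip_snd; apply: taylor2_neq0.
rewrite (rcomp_flip_snd_rid _ _ zI) (rcomp_flip_fst_rid _ _ (gI _ zI)).
have zI' := fI _ (gI _ zI).
by rewrite (rcomp_flip_snd_rid _ _ zI') (rcomp_flip_fst_rid _ _ (gI _ zI')).
Qed.

End Flips.

(** * The model *)

Lemma acos_right_angle (R : realType) (m a b : R) :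
  `|m| <= a -> `|m| <= b -> 0 < a -> 0 < b ->
  acos (- (m / Num.sqrt (a * b))) = pi / 2 -> m = 0.
Proof.
move=> ma mb a0 b0 acosE; have s0 : 0 < Num.sqrt (a * b).
  by rewrite sqrtr_gt0 mulr_gt0.
(* The two bounds put the argument of [acos] in [-1, 1], where [cos] undoes [acos]. *)
have ms : `|m / Num.sqrt (a * b)| <= 1.
  rewrite normrM normfV (gtr0_norm s0) ler_pdivrMr // mul1r -sqrtr_sqr.
  rewrite ler_sqrt; last by rewrite mulr_ge0 ?ltW.
  by rewrite -real_normK ?num_real //; apply: ler_pM.
have := @acosK R (- (m / Num.sqrt (a * b))).
rewrite acosE cos_pihalf in_itv /= -ler_norml normrN => /(_ ms)/eqP.
by rewrite eq_sym oppr_eq0 mulf_eq0 invr_eq0 (gt_eqF s0) orbF => /eqP.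
Qed.

Section Weights.
Variables (R : realType) (p : int -> int -> R).
Hypotheses (p_distr : is_distribution p) (p_nondeg : nondegenerate_model p).

Lemma weight_ge0 i j : i \in steps -> j \in steps -> 0 <= p i j.
Proof. by case: p_distr => + _; apply. Qed.

(** The factors [0 ^+ k] and [0 ^+ l] are kept because [0 ^+ 0] is 1. *)
Lemma momentE k l : moment p k l =
  (-1) ^+ k * ((-1) ^+ l * p (-1) (-1) + 0 ^+ l * p (-1) 0 + p (-1) 1)
  + 0 ^+ k * ((-1) ^+ l * p 0 (-1) + 0 ^+ l * p 0 0 + p 0 1)
  + ((-1) ^+ l * p 1 (-1) + 0 ^+ l * p 1 0 + p 1 1).
Proof.
rewrite /moment /steps !big_cons !big_nil /= !addr0 !rmorphN !rmorph1 !rmorph0.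
by rewrite !expr1n; ring.
Qed.

(** Three nonnegative weights consecutive in [contour]. Their sum is the value at y = 1 of the
    coefficient of x^2 in the kernel, which must be a unit at the fixed point. *)
Lemma west_neq0 : p (-1) 1 + p (-1) 0 + p (-1) (-1) != 0.
Proof.
apply: contraNneq p_nondeg => s0.
have := weight_ge0 (i := -1) (j := 1) isT isT.
have := weight_ge0 (i := -1) (j := 0) isT isT.
have := weight_ge0 (i := -1) (j := -1) isT isT => a0 b0 c0.
have a : p (-1) (-1) = 0 by lra.
have b : p (-1) 0 = 0 by lra.
have c : p (-1) 1 = 0 by lra.
by rewrite /contour a b c /= !eqxx !orbT.
Qed.

Lemma south_neq0 : p 1 (-1) + p 0 (-1) + p (-1) (-1) != 0.
Proof.
apply: contraNneq p_nondeg => s0.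
have := weight_ge0 (i := 1) (j := -1) isT isT.
have := weight_ge0 (i := 0) (j := -1) isT isT.
have := weight_ge0 (i := -1) (j := -1) isT isT => a0 b0 c0.
have a : p (-1) (-1) = 0 by lra.
have b : p 0 (-1) = 0 by lra.
have c : p 1 (-1) = 0 by lra.
by rewrite /contour a b c /= !eqxx !orbT.
Qed.

Lemma right_angle_moment : pi / angle p = 2 -> moment p 1 1 = 0.
Proof.
move=> pi_angle.
(* Division by zero gives 0, which is not 2. *)
have a0 : angle p != 0.
  apply/eqP => a0; move: pi_angle; rewrite a0 invr0 mulr0 => /eqP.
  by rewrite eq_sym pnatr_eq0.
have aE : angle p = pi / 2.
  by rewrite -pi_angle invf_div mulrC divfK // gt_eqF ?pi_gt0.
have W i j : i \in steps -> j \in steps -> 0 <= p i j by apply: weight_ge0.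
have wNN := W (-1) (-1) isT isT; have wN0 := W (-1) 0 isT isT.
have wN1 := W (-1) 1 isT isT; have w0N := W 0 (-1) isT isT.
have w01 := W 0 1 isT isT; have w1N := W 1 (-1) isT isT.
have w10 := W 1 0 isT isT; have w11 := W 1 1 isT isT.
have := west_neq0; have := south_neq0.
move: aE; rewrite /angle !momentE !expr0 !expr1 !expr0n /= !sqrrN !expr1n.
rewrite !(mul0r, mul1r, addr0, add0r).
move=> aE south west.
(* The bounds come from |ij| <= i^2 and |ij| <= j^2 on the steps; the second moments are positive
   because they dominate the west and south sums. *)
apply: acos_right_angle aE => //; last 2 first.
- by rewrite lt0r; apply/andP; split; [apply: contraNneq west => ? |]; lra.
- by rewrite lt0r; apply/andP; split; [apply: contraNneq south => ? |]; lra.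
- by rewrite ler_norml; apply/andP; split; lra.
- by rewrite ler_norml; apply/andP; split; lra.
Qed.

End Weights.

(** * Coefficients of the kernel *)

Section Kernel.
Variable R : realType.
Local Notation C := R[i].
Implicit Types p : int -> int -> R.

(** Reflection in the diagonal exchanges x and y in the kernel, so only coefficients of powers of x
    need computing. *)
Definition transpose p i j : R := p j i.

Lemma swap_kernel p : swapXY (kernel p) = kernel (transpose p).
Proof.
rewrite /kernel rmorphB /= rmorphM /= swapXY_X swapXY_Y (mulrC 'Y).
congr (_ - _).
rewrite rmorph_sum exchange_big /=; apply: eq_bigr => i _.
rewrite rmorph_sum; apply: eq_bigr => j _ /=.
rewrite !rmorphM !rmorphXn /= swapXY_X swapXY_Y swapXY_polyC map_polyC /=.
by rewrite mulrAC.
Qed.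

Lemma coef_monomial (a : C) n m k :
  (a%:P%:P * 'X ^+ n * 'Y ^+ m)`_k = if k == n then a%:P * 'X^m else 0.
Proof.
rewrite -polyC_exp mulrAC -polyCM coefCM coefXn.
by case: eqP; rewrite ?mulr1 ?mulr0.
Qed.

Lemma coef_kernel p k : (kernel p)`_k =
  \sum_(i <- steps) (if k == `|1 - i|%N then
     \sum_(j <- steps) (p i j)%:C%:P * 'X^(`|1 - j|%N) else 0)
  - (if k == 1 then 'X else 0).
Proof.
rewrite coefB coef_sum; congr (_ - _).
  apply: eq_bigr => i _; rewrite coef_sum.
  under eq_bigr do rewrite coef_monomial.
  by case: ifP => // _; rewrite big1.
by rewrite mulrC coefCM coefX; case: eqP; rewrite ?mulr1 ?mulr0.
Qed.

Lemma coef2_kernel p : (kernel p)`_2 =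
  (p (-1) 1)%:C%:P + (p (-1) 0)%:C%:P * 'X + (p (-1) (-1))%:C%:P * 'X^2.
Proof.
rewrite coef_kernel /steps !big_cons !big_nil /= !addr0 subr0.
by ring.
Qed.

Lemma coef0_kernel p : (kernel p)`_0 =
  (p 1 1)%:C%:P + (p 1 0)%:C%:P * 'X + (p 1 (-1))%:C%:P * 'X^2.
Proof.
rewrite coef_kernel /steps !big_cons !big_nil /= !addr0 !add0r subr0.
by ring.
Qed.

End Kernel.

Section KernelTaylor.
Variable R : realType.
Local Notation C := R[i].
Implicit Types p : int -> int -> R.

Lemma quadratic_taylor2 (a0 a1 a2 : C) :
  a0%:P + a1%:P * 'X + a2%:P * 'X^2 = taylor2 (a0 + a1 + a2) (a1 + a2 *+ 2) a2.
Proof. by rewrite /taylor2 !polyCD polyC1; ring. Qed.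

Lemma kernel2_taylor p : (kernel p)`_2 =
  taylor2 (p (-1) 1 + p (-1) 0 + p (-1) (-1))%:C
    (p (-1) 0 + p (-1) (-1) *+ 2)%:C (p (-1) (-1))%:C.
Proof. by rewrite coef2_kernel quadratic_taylor2 !(rmorphD, rmorphMn). Qed.

(** The first hypothesis, zero horizontal drift, equates the values at y = 1 of the coefficients of
    x^0 and x^2. The second, the vanishing of the mixed moment, then equates their derivatives. *)
Lemma kernel0_taylor p :
    p 1 1 + p 1 0 + p 1 (-1) = p (-1) 1 + p (-1) 0 + p (-1) (-1) ->
    p 1 1 - p 1 (-1) = p (-1) 1 - p (-1) (-1) ->
  (kernel p)`_0 =
  taylor2 (p (-1) 1 + p (-1) 0 + p (-1) (-1))%:C
    (p (-1) 0 + p (-1) (-1) *+ 2)%:C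
    ((p (-1) (-1))%:C + (p 1 (-1) - p (-1) (-1))%:C).
Proof.
move=> sE dE; rewrite coef0_kernel quadratic_taylor2 -!(rmorphD, rmorphMn).
by rewrite sE; congr (taylor2 _ _%:C _%:C); lra.
Qed.

End KernelTaylor.

(** * Specialisation to complex rational functions *)

Section RationalFunctions.
Variable R : realType.
Local Notation C := R[i].

Definition embed : {rmorphism {poly {poly C}} -> ratfun R} :=
  @FracField.tofrac {poly {poly C}}.

Lemma embed_inj : injective embed.
Proof. by move=> q q' /eqP; rewrite tofrac_eq => /eqP. Qed.

Lemma embed_surj (r : ratfun R) :
  exists n d : {poly {poly C}}, d != 0 /\ r = embed n / embed d.
Proof.
exists \n_(repr r), \d_(repr r); split; first exact: denom_ratioP.
rewrite -[r in LHS]reprK -{1}[repr r]Ratio_numden.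
move: \n_(repr r) \d_(repr r) (denom_ratioP (repr r)) => n d d0.
rewrite /embed /=; unlock FracField.tofrac.
rewrite -[X in _ * X]FracField.pi_inv -[RHS]FracField.pi_mul.
rewrite /FracField.mulf /FracField.invf /=.
by rewrite !numden_Ratio ?(oner_neq0, mul1r, mulr1).
Qed.

Local Notation c := (embed \o (polyC \o polyC)).

Lemma rat_subst_embed (n d : {poly {poly C}}) h : independent c h -> d != 0 ->
  rat_subst (embed n / embed d) h = subst2 c h n / subst2 c h d.
Proof. by move=> hI d0; apply: (@rat_substE R h n d hI d0). Qed.

Let embedC b : embed b%:P%:P = c b. Proof. by []. Qed.

Variable p : int -> int -> R.

Lemma Phi_flip : Phi p = flip_fst c (kernel p)`_0 (kernel p)`_2 (rid embed).
Proof.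
have E s : eval1 c (rid embed).2 s = embed s%:P.
  by rewrite -subst2_polyC (subst2_rid embedC).
by rewrite /flip_fst !E.
Qed.

Lemma Psi_flip : Psi p = flip_snd c (kernel (transpose p))`_0
  (kernel (transpose p))`_2 (rid embed).
Proof.
have E s : eval1 c (rid embed).1 s = embed s^:P.
  by rewrite -subst2_map_polyC (subst2_rid embedC).
by rewrite /flip_snd !E -swap_kernel.
Qed.

(** Holds by conversion: at [embed] and [rat_subst], [rsubgroup] unfolds to
    [birational_subgroup]. *)
Lemma model_group_flips : model_group p =
  smallest (rsubgroup embed (@rat_subst R)) [set Phi p; Psi p].
Proof. by []. Qed.

End RationalFunctions.

Theorem theorem9 (R : realType) (p : int -> int -> R)
    (p_distr : is_distribution p) (p_nondeg : nondegenerate_model p)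
    (p_drift : zero_drift p) (p_theta : pi / angle p = 2) :
  (north_south p \/ east_west p -> (model_group p #= `I_4)%card) /\
  (~ (north_south p \/ east_west p) -> infinite_set (model_group p)).
Proof.
have m11 := right_angle_moment p_distr p_nondeg p_theta.
have west := west_neq0 p_distr p_nondeg.
have south := south_neq0 p_distr p_nondeg.
have [m10 m01] := p_drift.
move: m11 m10 m01; rewrite !momentE !expr0 !expr1 !mul0r !mul1r !addr0.
move=> m11 m10 m01.
have xE : p 1 1 + p 1 0 + p 1 (-1) = p (-1) 1 + p (-1) 0 + p (-1) (-1) by lra.
have yE : p 1 1 + p 0 1 + p (-1) 1 = p 1 (-1) + p 0 (-1) + p (-1) (-1) by lra.
have dE : p 1 1 - p 1 (-1) = p (-1) 1 - p (-1) (-1) by lra.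
pose q := transpose p.
have q_sum : q 1 1 + q 1 0 + q 1 (-1) = q (-1) 1 + q (-1) 0 + q (-1) (-1) by [].
have q_diff : q 1 1 - q 1 (-1) = q (-1) 1 - q (-1) (-1).
  by rewrite /q /transpose; lra.
have westC : (p (-1) 1 + p (-1) 0 + p (-1) (-1))%:C != 0 by rewrite fmorph_eq0.
have southC : (q (-1) 1 + q (-1) 0 + q (-1) (-1))%:C != 0 by rewrite fmorph_eq0.
rewrite model_group_flips Phi_flip Psi_flip -/q.
have p2 := kernel2_taylor p; have p0 := kernel0_taylor xE dE.
have q2 := kernel2_taylor q; have q0 := kernel0_taylor q_sum q_diff.
split=> sym; last first.
  apply: (infinite_flip_group (@embed_inj R) (@embed_surj R)
    (@rat_subst_embed R) p0 p2 q0 q2 _ westC southC).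
  - by move=> m; rewrite pnatr_eq0.
  (* If k = 0, then [p 1 (-1) = p (-1) (-1)]; [dE] gives the case [j = 1], and then [xE] the case
     [j = 0]. *)
  - rewrite fmorph_eq0; apply: contra_notN sym => /eqP k0; right => j.
    by rewrite !inE => /or3P[] /eqP->; lra.
  - rewrite fmorph_eq0; apply: contra_notN sym => /eqP l0; left => i.
    by move: l0; rewrite /q /transpose !inE => l0 /or3P[] /eqP->; lra.
have t0 (n : {poly R[i]}) A B D : n = taylor2 A B D -> A != 0 -> n != 0.
  by move=> ->; apply: taylor2_neq0.
have p2_neq0 := t0 _ _ _ _ p2 westC; have p0_neq0 := t0 _ _ _ _ p0 westC.
have q2_neq0 := t0 _ _ _ _ q2 southC; have q0_neq0 := t0 _ _ _ _ q0 southC.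
case: sym => sym.
(* Under the North-South symmetry the coefficients of y^2 and y^0 coincide, and those of x^2 and x^0
   are palindromic in y. *)
- have qE : (kernel q)`_0 = (kernel q)`_2.
    by rewrite coef0_kernel coef2_kernel /q /transpose !sym.
  have p0E : (kernel p)`_0 = palindrome (p 1 1)%:C (p 1 0)%:C.
    by rewrite coef0_kernel -(sym 1).
  have p2E : (kernel p)`_2 = palindrome (p (-1) 1)%:C (p (-1) 0)%:C.
    by rewrite coef2_kernel -(sym (-1)).
  exact: (card_flip_group_north_south (@embed_inj R) (@embed_surj R)
    (@rat_subst_embed R) p0E p2E qE p0_neq0 p2_neq0 q2_neq0).
- have pE : (kernel p)`_0 = (kernel p)`_2.
    by rewrite coef0_kernel coef2_kernel !sym.
  have q0E : (kernel q)`_0 = palindrome (q 1 1)%:C (q 1 0)%:C.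
    by rewrite coef0_kernel /q /transpose -(sym 1).
  have q2E : (kernel q)`_2 = palindrome (q (-1) 1)%:C (q (-1) 0)%:C.
    by rewrite coef2_kernel /q /transpose -(sym (-1)).
  exact: (card_flip_group_east_west (@embed_inj R) (@embed_surj R)
    (@rat_subst_embed R) q0E q2E pE q0_neq0 q2_neq0 p2_neq0).
Qed.
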